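(* Let $k\geq 1$ and let $G$ be the sun graph on $m=8k$ vertices: its vertices are $v_0,\ldots,v_{4k-1}$ forming the cycle $v_0v_1\cdots v_{4k-1}v_0$, together with pendant vertices $u_0,\ldots,u_{4k-1}$, where $u_i$ is adjacent only to $v_i$. Define $a:V(G)\to\{0,\ldots,8k\}$ by $a(v_i)=i/2$ for $i$ even, $0\le i\le 2k-2$; $a(v_i)=8k-(i+1)/2$ for $i$ odd, $1\le i\le 2k-1$; $a(v_i)=i/2+2k-1$ for $i$ even, $2k\le i\le 4k-2$; $a(v_i)=6k-(i+1)/2$ for $i$ odd, $2k+1\le i\le 4k-1$; and $a(u_0)=8k$; $a(u_i)=6k-i/2$ for $i$ even, $2\le i\le 2k-2$; $a(u_i)=2k+(i-1)/2$ for $i$ odd, $1\le i\le 2k-3$; $a(u_{2k-1})=k$; $a(u_{2k})=5k$; $a(u_i)=8k-i/2$ for $i$ even, $2k+2\le i\le 4k-2$; $a(u_i)=(i+1)/2$ for $i$ odd, $2k+1\le i\le 4k-3$; $a(u_{4k-1})=4k-1$, where a case whose index range $a\le i\le b$ is empty (i.e. $a>b$) for the given $k$ is vacuous. Then $a$ is an $\alpha$-valuation of $G$.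
   Context: A $\beta$-valuation of a graph $G$ with $n$ edges is an injective map $b:V(G)\to\{0,1,\ldots,n\}$ such that the multiset $\{|b(u)-b(v)| : \{u,v\}\in E(G)\}$ equals $\{1,\ldots,n\}$. An $\alpha$-valuation is a $\beta$-valuation $b$ for which there exists an integer $x$, $0\le x\le n$, such that every edge $\{u,v\}$ satisfies $b(u)\le x<b(v)$ or $b(v)\le x<b(u)$. The sun graph here has $8k$ edges. *)

(* Defs.v *)
From mathcomp Require Import all_boot all_order all_algebra.

Set Implicit Arguments.
Unset Strict Implicit.
Unset Printing Implicit Defensive.

Record sgraph := SGraph {
  vertex : finType;
  adj : rel vertex;
  adj_sym : symmetric adj;
  adj_irrefl : irreflexive adj
}.

Definition edges (G : sgraph) : {set {set vertex G}} :=
  [set [set p.1; p.2] | p : vertex G * vertex G & adj p.1 p.2].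

(* |b(u) - b(v)| for e = {u, v}; the maximum makes the value independent of the
   order of the two ends, see edge_label2. *)
Definition edge_label (T : finType) (b : T -> nat) (e : {set T}) : nat :=
  \max_(u in e) \max_(v in e) `|b u - b v|.

Lemma edge_label2 (T : finType) (b : T -> nat) (u v : T) :
  edge_label b [set u; v] = `|b u - b v|.
Proof.
apply/eqP; rewrite eqn_leq; apply/andP; split.
  apply/bigmax_leqP => x /set2P[] ->; apply/bigmax_leqP => y /set2P[] ->;
    by rewrite ?distnn // distnC.
apply: (bigmax_sup u); first by rewrite set21.
by apply: (bigmax_sup v); first by rewrite set22.
Qed.

Definition beta_valuation (G : sgraph) (b : vertex G -> nat) : Prop :=
  [/\ injective b,
      forall v, b v <= #|edges G|
    & perm_eq [seq edge_label b e | e <- enum (edges G)] (iota 1 #|edges G|)].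

Definition alpha_valuation (G : sgraph) (b : vertex G -> nat) : Prop :=
  beta_valuation b /\
  exists2 x : nat, x <= #|edges G|
    & forall u v, adj u v -> (b u <= x < b v) || (b v <= x < b u).

(* inl i is the cycle vertex v_i and inr i the pendant vertex u_i; the inl part
   is a cycle for n >= 3. *)
Definition sun_adj (n : nat) (p q : 'I_n + 'I_n) : bool :=
  match p, q with
  | inl i, inl j => (i != j) && ((j == ordS i) || (i == ordS j))
  | inl i, inr j => i == j
  | inr i, inl j => i == j
  | inr _, inr _ => false
  end.

Lemma sun_adj_sym n : symmetric (@sun_adj n).
Proof. by move=> [i|i] [j|j] //=; rewrite eq_sym // orbC. Qed.

Lemma sun_adj_irrefl n : irreflexive (@sun_adj n).
Proof. by move=> [i|i] //=; rewrite eqxx. Qed.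

Definition sun_graph (n : nat) : sgraph :=
  SGraph (@sun_adj_sym n) (@sun_adj_irrefl n).

(* For k >= 1 exactly one guard holds for each i < 4k, and no subtraction that
   matters truncates: when k = 1, 2k - 3 is 0 instead of -1, and no odd i is
   <= 0. *)
Definition sun_cycle_label (k i : nat) : nat :=
  if ~~ odd i && (0 <= i <= 2 * k - 2) then i %/ 2
  else if odd i && (1 <= i <= 2 * k - 1) then 8 * k - (i + 1) %/ 2
  else if ~~ odd i && (2 * k <= i <= 4 * k - 2) then i %/ 2 + 2 * k - 1
  else if odd i && (2 * k + 1 <= i <= 4 * k - 1) then 6 * k - (i + 1) %/ 2
  else 0.

Definition sun_pendant_label (k i : nat) : nat :=
  if i == 0 then 8 * k
  else if ~~ odd i && (2 <= i <= 2 * k - 2) then 6 * k - i %/ 2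
  else if odd i && (1 <= i <= 2 * k - 3) then 2 * k + (i - 1) %/ 2
  else if i == 2 * k - 1 then k
  else if i == 2 * k then 5 * k
  else if ~~ odd i && (2 * k + 2 <= i <= 4 * k - 2) then 8 * k - i %/ 2
  else if odd i && (2 * k + 1 <= i <= 4 * k - 3) then (i + 1) %/ 2
  else if i == 4 * k - 1 then 4 * k - 1
  else 0.

Definition sun_label (k : nat) (w : vertex (sun_graph (4 * k))) : nat :=
  match w with
  | inl i => sun_cycle_label k i
  | inr i => sun_pendant_label k i
  end.

(* Main.v *)
(* An edge of the sun is v_i v_{i+1} or v_i u_i, so the 8k edges are indexed by
   'I_(4k) + 'I_(4k).  The differences along the cycle fill [2, 2k], {4k},
   {4k+1} and [6k+1, 8k-1], those on the pendant edges fill {1}, [2k+1, 4k-1],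
   [4k+2, 6k] and {8k}; by pigeonhole it is enough that they are pairwise
   distinct and lie in [1, 8k].  The labels at most 4k-1 are those of v_i for i
   even and of u_i for i odd, which is one side of the bipartition. *)
Require Import Defs.
From mathcomp Require Import all_boot all_order all_algebra.
From mathcomp Require Import zify.

Set Implicit Arguments.
Unset Strict Implicit.
Unset Printing Implicit Defensive.

(** Distinct labels force distinct edges, so there are [#|I|] edges; a duplicate-free list of that
    length inside [iota 1 #|I|] must exhaust it. *)
Lemma edge_labels_perm_iota (G : sgraph) (b : vertex G -> nat) (I : finType)
    (p q : I -> vertex G) :
  edges G = [set [set p i; q i] | i : I] ->
  injective (fun i => `|b (p i) - b (q i)|) ->
  (forall i, 1 <= `|b (p i) - b (q i)| <= #|I|) ->
  #|edges G| = #|I| /\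
  perm_eq [seq edge_label b e | e <- enum (edges G)] (iota 1 #|edges G|).
Proof.
move=> edgesE label_inj label_bd.
have ends_inj : injective (fun i => [set p i; q i]).
  by move=> i j eq_ij; apply: label_inj; rewrite /= -!edge_label2 eq_ij.
have cardI : #|edges G| = #|I| by rewrite edgesE card_imset.
split=> //; rewrite cardI.
have labels_uniq : uniq [seq edge_label b e | e <- enum (edges G)].
  rewrite map_inj_in_uniq ?enum_uniq // => e f.
  rewrite !mem_enum edgesE => /imsetP[i _ ->] /imsetP[j _ ->].
  by rewrite !edge_label2 => /label_inj ->.
have labels_sub : {subset [seq edge_label b e | e <- enum (edges G)]
                   <= iota 1 #|I|}.
  move=> l /mapP[e]; rewrite mem_enum edgesE => /imsetP[i _ ->] ->.
  by rewrite edge_label2 mem_iota add1n ltnS label_bd.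
apply: uniq_perm; rewrite ?iota_uniq //.
have [|//] := uniq_min_size labels_uniq labels_sub.
by rewrite size_map size_iota -cardE cardI.
Qed.

Definition sun_end (n : nat) (e : 'I_n + 'I_n) : vertex (sun_graph n) :=
  match e with inl i => inl (ordS i) | inr i => inr i end.

Definition sun_base (n : nat) (e : 'I_n + 'I_n) : vertex (sun_graph n) :=
  match e with inl i => inl i | inr i => inl i end.

Lemma ordS_neq n (i : 'I_n) : 1 < n -> i != ordS i.
Proof.
move=> n_gt1; rewrite -val_eqE /=; have := ltn_ord i.
by rewrite leq_eqVlt => /orP[/eqP iE|/modn_small ->]; rewrite ?iE ?modnn; lia.
Qed.

(** The indexing may repeat an edge: for [n = 2] both cycle indices name the same one, which an
    equality of sets tolerates. *)
Lemma sun_edgesE n : 1 < n ->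
  edges (sun_graph n) = [set [set sun_base e; sun_end e] | e : 'I_n + 'I_n].
Proof.
move=> n_gt1; apply/setP=> E; apply/imsetP/imsetP.
- case=> -[[i|i] [j|j]]; rewrite inE //=.
  + move=> /andP[_ /orP[]/eqP-> ->]; first by exists (inl i).
    by exists (inl j); rewrite //= setUC.
  + by move=> /eqP-> ->; exists (inr j).
  + by move=> /eqP-> ->; exists (inr j); rewrite //= setUC.
- case=> -[i|i] _ -> /=.
    by exists (inl i, inl (ordS i)); rewrite // inE /= ordS_neq ?eqxx.
  by exists (inl i, inr i); rewrite // inE /= eqxx.
Qed.

Lemma sun_cycle_labelE k i : i < 4 * k ->
  sun_cycle_label k i =
  if odd i then (if i < 2 * k then 8 * k else 6 * k) - i./2.+1
  else if i < 2 * k then i./2 else i./2 + 2 * k - 1.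
Proof. by rewrite /sun_cycle_label => lti; do ?[case: ifP => ?]; lia. Qed.

Lemma sun_pendant_labelE k i : i < 4 * k ->
  sun_pendant_label k i =
  if odd i then
    if i == 2 * k - 1 then k else if i == 4 * k - 1 then 4 * k - 1
    else if i < 2 * k then 2 * k + i./2 else i./2.+1
  else
    if i == 0 then 8 * k else if i == 2 * k then 5 * k
    else if i < 2 * k then 6 * k - i./2 else 8 * k - i./2.
Proof. by rewrite /sun_pendant_label => lti; do ?[case: ifP => ?]; lia. Qed.

(** The labels zigzag along the cycle, so the difference drops by one per step. The exceptions are
    [2 * k - 1], where the labelling formulas change, and [4 * k - 1], where the cycle closes at
    [v_0]. *)
Definition sun_cycle_diff (k i : nat) : nat :=
  if i < 2 * k - 1 then 8 * k - 1 - i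
  else if i == 2 * k - 1 then 4 * k + 1
  else if i < 4 * k - 1 then 4 * k - i
  else 4 * k.

(** Parity keeps the last two progressions apart: odd [i] gives the even values in [2k+2, 4k-2],
    even [i] the odd values in [2k+3, 4k-1]. *)
Definition sun_pendant_diff (k i : nat) : nat :=
  if i == 0 then 8 * k
  else if i < 2 * k - 1 then 6 * k - i
  else if i == 2 * k - 1 then 6 * k
  else if i == 2 * k then 2 * k + 1
  else if i == 4 * k - 1 then 1
  else if odd i then 6 * k - 1 - i else 6 * k + 1 - i.

Definition sun_diff (k : nat) (e : 'I_(4 * k) + 'I_(4 * k)) : nat :=
  match e with inl i => sun_cycle_diff k i | inr i => sun_pendant_diff k i end.

Lemma sun_diff_inj k : injective (@sun_diff k).
Proof.
by move=> [i|i] [j|j] /=; have := ltn_ord i; have := ltn_ord j;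
   rewrite /sun_cycle_diff /sun_pendant_diff => ltj lti;
   do ?[case: ifP => ?]; move=> eq_ij;
   first [exfalso; lia | congr (_ _); apply: val_inj => /=; lia].
Qed.

Lemma sun_diff_bounds k (e : 'I_(4 * k) + 'I_(4 * k)) :
  1 <= sun_diff e <= 8 * k.
Proof.
by case: e => i /=; have := ltn_ord i;
   rewrite /sun_cycle_diff /sun_pendant_diff => lti; do ?[case: ifP => ?]; lia.
Qed.

Lemma sun_label_diff k (e : 'I_(4 * k) + 'I_(4 * k)) :
  `|sun_label (sun_base e) - sun_label (sun_end e)| = sun_diff e.
Proof.
case: e => i /=; have lti := ltn_ord i; last first.
  rewrite sun_cycle_labelE // sun_pendant_labelE // /sun_pendant_diff.
  by do ?[case: ifP => ?]; lia.
have n_gt0 := leq_ltn_trans (leq0n i) lti.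
rewrite !sun_cycle_labelE ?ltn_pmod // /sun_cycle_diff.
(* Only at the last index does [ordS] wrap around, to [v_0]. *)
move: (lti); rewrite leq_eqVlt => /orP[/eqP iE|ltSi].
  by rewrite iE modnn; do ?[case: ifP => ?]; lia.
by rewrite (modn_small ltSi); do ?[case: ifP => ?]; lia.
Qed.

(** The branches take values in disjoint intervals. For even [i], [v_i] fills [0, k-1] and
    [3k-1, 4k-2]; for odd [i], [u_i] fills [k, 3k-2] and {4k-1}. The other vertices fill [4k, 8k]
    except 6k. *)
Lemma sun_label_inj k : injective (@sun_label k).
Proof.
by move=> [i|i] [j|j] /=; have := ltn_ord i; have := ltn_ord j;
   rewrite ?sun_cycle_labelE ?sun_pendant_labelE // => ltj lti;
   do ?[case: ifP => ?]; move=> eq_ij;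
   first [exfalso; lia | congr (_ _); apply: val_inj => /=; lia].
Qed.

Lemma sun_label_le k (w : vertex (sun_graph (4 * k))) : sun_label w <= 8 * k.
Proof.
by case: w => i /=; have := ltn_ord i;
   rewrite ?sun_cycle_labelE ?sun_pendant_labelE // => lti;
   do ?[case: ifP => ?]; lia.
Qed.

Definition sun_low (n : nat) (w : vertex (sun_graph n)) : bool :=
  match w with inl i => ~~ odd i | inr i => odd i end.

(** The threshold is tight: [u_(4k-1)] has label 4k-1 and [v_(4k-1)] has label 4k. *)
Lemma sun_label_low k (w : vertex (sun_graph (4 * k))) :
  (sun_label w <= 4 * k - 1) = sun_low w.
Proof.
by case: w => i /=; have := ltn_ord i;
   rewrite ?sun_cycle_labelE ?sun_pendant_labelE // => lti;
   do ?[case: ifP => ?]; lia.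
Qed.

(** The wrap from [n - 1] to 0 also flips parity, because [n] is even. *)
Lemma odd_ordS n (i : 'I_n) : ~~ odd n -> odd (ordS i) = ~~ odd i.
Proof.
move=> n_even /=; have := ltn_ord i.
by rewrite leq_eqVlt => /orP[/eqP iE|/modn_small -> //]; rewrite iE modnn; lia.
Qed.

Lemma sun_low_adj n (u v : vertex (sun_graph n)) :
  ~~ odd n -> adj u v -> sun_low u = ~~ sun_low v.
Proof.
move=> n_even; case: u v => [i|i] [j|j] //=.
- by case/andP=> _ /orP[]/eqP->; rewrite odd_ordS ?negbK.
- by move/eqP->.
- by move/eqP->; rewrite negbK.
Qed.

Theorem theorem8p3 (k : nat) (hk : 1 <= k) : alpha_valuation (@sun_label k).
Proof.
have card_sum_ord : #|{: 'I_(4 * k) + 'I_(4 * k)}| = 8 * k.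
  by rewrite card_sum card_ord; lia.
have [||e|cardE permE] := edge_labels_perm_iota (b := @sun_label k)
    (@sun_edgesE (4 * k) _).
(* This is [1 < 4 * k], which follows from [hk]. *)
- lia.
- by move=> e f; rewrite !sun_label_diff => /sun_diff_inj.
- by rewrite sun_label_diff card_sum_ord sun_diff_bounds.
split; first by split=> //; [exact: sun_label_inj
  | move=> w; rewrite cardE card_sum_ord sun_label_le].
exists (4 * k - 1) => [|u v /sun_low_adj low_uv].
  by rewrite cardE card_sum_ord; lia.
have {}low_uv : sun_low u = ~~ sun_low v by apply: low_uv; lia.
by rewrite !ltnNge !sun_label_low low_uv; case: (sun_low v).
Qed.
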